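(* Assume the seeds are i.i.d. uniform on $[n]$. Let $(m(n))$, indexed by even $n\ge6$, be a sequence of positive integers with $m(n)=o(\sqrt n)$, let $\eta\in(0,\tfrac12)$ be fixed, and let $(l_n)$ be integers with $2\le l_n<n/2$ and $l_n=\eta n+o(\sqrt n)$. Then: (i) if $\lim_{n\to\infty}m(n)=m_0\in\mathbb N$, then $\lim_{n\to\infty}p_1(n,m(n),l_n)=p(\infty,m_0,\eta)$; (ii) if $\lim_{n\to\infty}m(n)=\infty$, then $\lim_{n\to\infty}p_1(n,m(n),l_n)=\lim_{m\to\infty}p(\infty,m,\eta)=1$.
   Context: Discrete model: candidates $[n]$, $m$ voters; voter $j$ has the clockwise oriented preference list $(s_j,s_j+1,\dots,n,1,\dots,s_j-1)$ with seed $s_j$; seeds independent uniform on $[n]$. In an election among a non-empty $S\subseteq[n]$ each voter votes for the first candidate of $S$ in its list; $\Xi_S(i)$ is the number of votes for $i$. Two-round election with partition $(A,B)$: the winner of $A$ is the $a\in A$ with $\Xi_A(a)>\Xi_A(a')$ for all other $a'\in A$ (if none, nobody wins); likewise for $B$; between first-round winners $a,b$, $a$ wins iff $\Xi_{\{a,b\}}(a)>\Xi_{\{a,b\}}(b)$ (ties: nobody wins). $A^{(1,n,l)}=\{1,\dots,l\}\cup\{l+2i:1\le i\le(n-2l)/2\}$, $B^{(1,n,l)}=[n]\setminus A^{(1,n,l)}$, and $p_1(n,m,l)$ is the probability that candidate 1 wins with partition $(A^{(1,n,l)},B^{(1,n,l)})$. Continuous model: $U_1,\dots,U_m$ i.i.d.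 uniform on $[0,1)$, and for an arc $(a,b)$ of the circle $[0,1)$ (taken mod 1), $N_{(a,b)}=\sum_{j=1}^m\mathbf I_{(a,b)}(U_j)$. For $\eta\in(0,\tfrac12)$, $p(\infty,m,\eta)$ is the probability of the event $\{N_{(1-\eta,1)}\ge2,\ N_{(0,\eta)}\ge2,\ N_{(0,\eta)}<m/2\}$; explicitly $$p(\infty,m,\eta)=\sum_{s=2}^{\lfloor (m-1)/2\rfloor}\sum_{t=2}^{m-s}\frac{m!}{s!\,t!\,(m-s-t)!}\eta^{s+t}(1-2\eta)^{m-s-t}.$$ *)

(* Defs.v *)
From HB Require Import structures.
From mathcomp Require Import all_boot all_order all_algebra.
From mathcomp Require Import all_classical all_reals all_analysis.
Set Implicit Arguments. Unset Strict Implicit. Unset Printing Implicit Defensive.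
Import Order.TTheory GRing.Theory Num.Theory.
Import numFieldNormedType.Exports.
Local Open Scope ring_scope.

(* Candidates are the natural numbers 1..n.  A seed s in 1..n gives the
   clockwise list (s, s+1, ..., n, 1, ..., s-1); the position of candidate c
   in that list is (c - s) mod n. *)
Definition cpos (n s c : nat) : nat := ((c + n - s) %% n)%N.

Definition votes_for (n : nat) (S : pred nat) (s c : nat) : bool :=
  [&& (1 <= c <= n)%N, S c &
      all (fun c' => S c' ==> (cpos n s c <= cpos n s c')%N) (iota 1 n)].

(* seeds of the m voters: f : {ffun 'I_m -> 'I_n}; voter j has seed (f j).+1 *)
Definition Xi (n m : nat) (f : {ffun 'I_m -> 'I_n}) (S : pred nat) (c : nat)
  : nat := #|[set j : 'I_m | votes_for n S (f j).+1 c]|.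

Definition round_winner n m (f : {ffun 'I_m -> 'I_n}) (S : pred nat) (a : nat)
  : bool :=
  [&& (1 <= a <= n)%N, S a &
      all (fun a' => (S a' && (a' != a)) ==> (Xi f S a' < Xi f S a)%N)
          (iota 1 n)].

Definition wins_two_round n m (f : {ffun 'I_m -> 'I_n}) (A B : pred nat)
  (i : nat) : bool :=
  has (fun a => has (fun b =>
     [&& round_winner f A a, round_winner f B b &
       (let S2 := pred2 a b in
        ((a == i) && (Xi f S2 b < Xi f S2 a)%N) ||
        ((b == i) && (Xi f S2 a < Xi f S2 b)%N))]) (iota 1 n)) (iota 1 n).

Definition A1 (n l : nat) : pred nat :=
  fun c => ((1 <= c <= l)%N || has (fun i => c == (l + 2 * i)%N)
                                  (iota 1 ((n - 2 * l) %/ 2)%N)).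
Definition B1 (n l : nat) : pred nat :=
  fun c => (1 <= c <= n)%N && ~~ A1 n l c.

Definition p1 {R : realType} (n m l : nat) : R :=
  (#|[set f : {ffun 'I_m -> 'I_n} | wins_two_round f (A1 n l) (B1 n l) 1]|%:R)
  / ((n ^ m)%N)%:R.

Definition p_inf {R : realType} (m : nat) (eta : R) : R :=
  \sum_(2 <= s < ((m - 1) %/ 2).+1)
    \sum_(2 <= t < (m - s).+1)
      ((m`!)%:R / ((s`! * t`! * (m - s - t)`!)%N)%:R)
      * eta ^+ (s + t) * (1 - 2 * eta) ^+ (m - s - t).

(* Main.v *)
Require Import Defs.
From HB Require Import structures.
From mathcomp Require Import all_boot all_order all_algebra.
From mathcomp Require Import all_classical all_reals all_analysis.
From mathcomp Require Import zify ring lra.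
Import Order.TTheory GRing.Theory Num.Theory.
Import numFieldNormedType.Exports.
Local Open Scope ring_scope.

(* Apart from candidate 1 in A and candidate l+1 in B, a candidate c can only
   collect votes from the seeds c-1 and c, while 1 collects (inside A) those of
   the seeds 1, n-l+1, ..., n and l+1 (inside B) those of 1, ..., l+1.  If no
   two seeds are equal or adjacent and no seed is 1 or l+1, which fails with
   probability at most (2m^2 + 2m)/n, candidate 1 therefore wins exactly when at
   least two seeds lie in the last l positions, at least two in the first l, and
   fewer than m/2 in the first l.  The probability of that event is
   p(oo, m, l/n), so |p_1(n,m,l) - p(oo,m,l/n)| <= 4 (m / sqrt n)^2.  For m
   fixed one concludes by continuity of p(oo, m, _); for m -> oo by Chebyshev's
   inequality, which is uniform for the parameter in a compact subset of
   (0, 1/2). *)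

(** * Vote counts *)

Lemma cpos_cases (n s c : nat) : (1 <= s <= n)%N -> (1 <= c <= n)%N ->
  (s <= c)%N /\ cpos n s c = (c - s)%N \/ (c < s)%N /\ cpos n s c = (c + n - s)%N.
Proof.
move=> hs hc; rewrite /cpos; case: (leqP s c) => h; [left|right]; split=> //.
  have -> : (c + n - s = c - s + n)%N by lia.
  by rewrite modnDr modn_small //; lia.
by rewrite modn_small //; lia.
Qed.

Lemma votes_forP (n : nat) (S : pred nat) (s c : nat) :
  reflect [/\ (1 <= c <= n)%N, S c & forall c', (1 <= c' <= n)%N -> S c' ->
             (cpos n s c <= cpos n s c')%N]
          (votes_for n S s c).
Proof.
apply: (iffP and3P) => [[h1 h2 /allP h3]|[h1 h2 h3]]; split=> //.
  by move=> c' hc' Sc'; apply: (implyP (h3 c' _)); rewrite // mem_iota; lia.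
by apply/allP => c'; rewrite mem_iota => hc'; apply/implyP; apply: h3; lia.
Qed.

Lemma votes_for_exists (n : nat) (S : pred nat) (s c0 : nat) :
  (1 <= c0 <= n)%N -> S c0 -> exists c, votes_for n S s c.
Proof.
move=> hc0 Sc0.
pose P k := has (fun c => S c && (cpos n s c == k)) (iota 1 n).
have exP : exists k, P k.
  exists (cpos n s c0); apply/hasP; exists c0; first by rewrite mem_iota; lia.
  by rewrite Sc0 eqxx.
case: (ex_minnP exP) => k /hasP[c]; rewrite mem_iota => hc /andP[Sc /eqP ck] kmin.
exists c; apply/votes_forP; split=> //.
move=> c' hc' Sc'; rewrite ck; apply: kmin; apply/hasP; exists c'.
  by rewrite mem_iota; lia.
by rewrite Sc' eqxx.
Qed.

(** Only the seed itself is at position 0 of its list. *)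
Lemma votes_for_self (n : nat) (S : pred nat) (s c : nat) :
  (1 <= s <= n)%N -> S s -> votes_for n S s c -> c = s.
Proof.
move=> hs Ss /votes_forP[hc Sc /(_ _ hs Ss)].
by have := cpos_cases _ _ _ hs hc; have := cpos_cases _ _ _ hs hs; lia.
Qed.

(* The gap condition makes every [c <> c0] a candidate that can only be
   chosen by the seeds [c - 1] and [c]. *)
Definition dense_between (n : nat) (S : pred nat) (c0 c1 : nat) : Prop :=
  [/\ [/\ (1 <= c0)%N, (c0 <= c1)%N & (c1 <= n)%N], S c0, S c1,
      (forall c, (1 <= c <= n)%N -> S c -> (c0 <= c <= c1)%N)
    & (forall c, (1 <= c <= n)%N -> S c -> c <> c0 ->
         S (c - 1)%N \/ (c0 <= c - 2)%N /\ S (c - 2)%N)].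

(** Comparing with the last candidate [c1] is enough: a seed in [c0 + 1 .. c1] meets [c1] before it
    wraps round to [c0], while any other seed meets [c0] before the rest of [S]. *)
Lemma votes_for_first (n : nat) (S : pred nat) (c0 c1 s : nat) :
  [/\ (1 <= c0)%N, (c0 <= c1)%N & (c1 <= n)%N] -> S c0 -> S c1 ->
  (forall c, (1 <= c <= n)%N -> S c -> (c0 <= c <= c1)%N) ->
  (1 <= s <= n)%N ->
  votes_for n S s c0 = (s <= c0)%N || (c1 < s)%N.
Proof.
move=> [h1 h2 h3] S0 S1 hS hs; apply/votes_forP/idP.
  case=> _ _ /(_ c1 ltac:(lia) S1).
  by have := cpos_cases n s c0 hs; have := cpos_cases n s c1 hs; lia.
move=> h; split=> //; first by lia.
move=> c hc Sc; have := hS c hc Sc.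
by have := cpos_cases n s c0 hs; have := cpos_cases n s c hs; lia.
Qed.

(** A seed beyond [c] wraps round and meets [c0] before [c]; a seed below [c - 1] meets [c - 1] or
    [c - 2] first, whichever the gap condition puts in [S]. The bound [c0 <= c - 2] keeps the
    truncated subtraction a genuine candidate. *)
Lemma votes_for_other (n : nat) (S : pred nat) (c0 c1 s c : nat) :
  dense_between n S c0 c1 -> (1 <= s <= n)%N -> c <> c0 ->
  votes_for n S s c -> (s <= c <= s.+1)%N.
Proof.
move=> [[h1 h2 h3] S0 S1 hS gap] hs cc0 /votes_forP[hc Sc cmin].
have c0c := hS c hc Sc.
have sc : (s <= c)%N.
  have := cmin c0 ltac:(lia) S0.
  by have := cpos_cases n s c hs; have := cpos_cases n s c0 hs; lia.
rewrite sc /=.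
case: (gap c hc Sc cc0) => [Sc1|[c0c2 Sc2]].
  have := cmin (c - 1)%N ltac:(lia) Sc1.
  by have := cpos_cases n s c hs; have := cpos_cases n s (c - 1)%N hs; lia.
have := cmin (c - 2)%N ltac:(lia) Sc2.
by have := cpos_cases n s c hs; have := cpos_cases n s (c - 2)%N hs; lia.
Qed.

(** Since [n] is even, the steps of two from [l] end exactly at [n - l], so membership in the middle
    block is a parity condition. *)
Lemma A1E (n l c : nat) : ~~ odd n -> (2 * l < n)%N ->
  A1 n l c = (1 <= c <= l)%N || [&& (l < c)%N, (c <= n - l)%N & ~~ odd (c - l)].
Proof.
move=> nE ln; rewrite /A1; congr (_ || _); apply/hasP/idP.
  by case=> i; rewrite mem_iota => hi /eqP ->; lia.
move=> /and3P[h1 h2 h3]; exists ((c - l) %/ 2)%N; first by rewrite mem_iota; lia.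
by apply/eqP; lia.
Qed.

Lemma A1_dense (n l : nat) : ~~ odd n -> (2 <= l)%N -> (2 * l < n)%N ->
  dense_between n (A1 n l) 1 (n - l).
Proof.
move=> nE l2 ln; split; rewrite ?A1E //; try (by lia); first by split; lia.
  by move=> c hc; rewrite A1E //; lia.
by move=> c hc; rewrite !A1E //; lia.
Qed.

(** [B1] runs through [l + 1, l + 3, ..., n - l - 1] in steps of two and then through
    [n - l + 1, ..., n] in steps of one; the junction is again a step of two. *)
Lemma B1_dense (n l : nat) : ~~ odd n -> (2 <= l)%N -> (2 * l < n)%N ->
  dense_between n (B1 n l) l.+1 n.
Proof.
move=> nE l2 ln; split; rewrite /B1 ?A1E //; try (by lia); first by split; lia.
  by move=> c hc; rewrite A1E //; lia.
by move=> c hc; rewrite !A1E //; lia.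
Qed.

(** * Vote counts and round winners for separated seeds *)

Section Votes.
Variables (n m : nat) (f : {ffun 'I_m -> 'I_n}).
Implicit Types (S : pred nat) (c : nat).

Lemma seed_bounds (j : 'I_m) : (1 <= (f j).+1 <= n)%N.
Proof. exact: ltn_ord. Qed.

Lemma Xi_first S c0 c1 :
  [/\ (1 <= c0)%N, (c0 <= c1)%N & (c1 <= n)%N] -> S c0 -> S c1 ->
  (forall c, (1 <= c <= n)%N -> S c -> (c0 <= c <= c1)%N) ->
  Xi f S c0 = #|[pred j | ((f j).+1 <= c0)%N || (c1 < (f j).+1)%N]|.
Proof.
move=> h S0 S1 hS; rewrite /Xi; apply: eq_card => j.
by rewrite !inE (votes_for_first _ _ _ _ _ h) // seed_bounds.
Qed.

(** Ordered pairs cover both directions of adjacency. Adjacency is not cyclic: the seeds [n] and 1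
    count as apart. *)
Definition separated : Prop :=
  forall i j : 'I_m, i != j -> f i != f j /\ (f i).+1 != f j :> nat.

(** Two voters for [c] would both have their seeds in [{c - 1, c}], hence equal or adjacent. *)
Lemma Xi_other_le1 S c0 c1 c :
  separated -> dense_between n S c0 c1 -> c <> c0 -> (Xi f S c <= 1)%N.
Proof.
move=> sep dS cc0; rewrite /Xi; apply/card_le1P => i; rewrite !inE => vi j.
rewrite !inE.
apply/idP/eqP => [vj|-> //]; apply/eqP; apply: contraT => ij.
have := votes_for_other _ _ _ _ _ _ dS (seed_bounds i) cc0 vi.
have := votes_for_other _ _ _ _ _ _ dS (seed_bounds j) cc0 vj.
have [] := sep _ _ ij; have [_] := sep i j ltac:(by rewrite eq_sym).
by rewrite -(inj_eq val_inj) /=; lia.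
Qed.

Lemma round_winnerP S a :
  reflect [/\ (1 <= a <= n)%N, S a & forall a', (1 <= a' <= n)%N -> S a' ->
             a' != a -> (Xi f S a' < Xi f S a)%N]
          (round_winner f S a).
Proof.
apply: (iffP and3P) => [[h1 h2 /allP h3]|[h1 h2 h3]]; split=> //.
  by move=> c hc Sc ca; apply: (implyP (h3 c _)); rewrite ?Sc // mem_iota; lia.
apply/allP => c; rewrite mem_iota => hc; apply/implyP => /andP[]; apply: h3; lia.
Qed.

(** Any vote for a rival would already tie with a winner who has at most one vote. *)
Lemma round_winner_unanimous S a : round_winner f S a -> (Xi f S a <= 1)%N ->
  forall j, votes_for n S (f j).+1 a.
Proof.
move=> /round_winnerP[ha Sa win] X1 j.
have [c vc] := votes_for_exists n S (f j).+1 a ha Sa.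
case: (eqVneq c a) => [<- //|ca].
have [hc Sc _] := votes_forP _ _ _ _ vc.
have := win c hc Sc ca.
suff : (0 < Xi f S c)%N by lia.
by rewrite /Xi card_gt0; apply/set0Pn; exists j; rewrite inE.
Qed.

Lemma round_winner_le1 S a :
  round_winner f S a -> (Xi f S a <= 1)%N -> (m <= 1)%N.
Proof.
move=> win X1; have := round_winner_unanimous _ _ win X1 => vote.
suff <- : Xi f S a = m by [].
rewrite -[RHS]card_ord /Xi; apply: eq_card => j.
by rewrite !inE vote.
Qed.
End Votes.

(* [Some true], [Some false] and [None] stand for the arcs (0, eta),
   (1 - eta, 1) and the rest of the circle.  The argument is the 0-based seed. *)
Definition seed_class (n l : nat) (u : 'I_n) : option bool :=
  if (u < l)%N then Some true else if (n - l <= u)%N then Some false else None.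

Lemma seed_class_true (n l : nat) (u : 'I_n) :
  (seed_class n l u == Some true) = (u < l)%N.
Proof. by rewrite /seed_class; case: ltnP => // _; case: leqP. Qed.

Lemma seed_class_false (n l : nat) (u : 'I_n) : (2 * l <= n)%N ->
  (seed_class n l u == Some false) = (n - l <= u)%N.
Proof.
move=> ln; rewrite /seed_class; case: ltnP => ul; last by case: leqP.
by apply/esym/negbTE; rewrite -ltnNge; lia.
Qed.

Definition hits {m} (h : {ffun 'I_m -> option bool}) (b : bool) : nat :=
  #|[pred j | h j == Some b]|.

(** This is the event behind [p_inf]: [hits h false] stands for the count on (1 - eta, 1) and
    [hits h true] for the count on (0, eta). *)
Definition win_event {m} (h : {ffun 'I_m -> option bool}) : bool :=
  [&& (2 <= hits h false)%N, (2 <= hits h true)%N & (2 * hits h true < m)%N].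

Lemma wins_two_roundP (n m : nat) (f : {ffun 'I_m -> 'I_n}) (A B : pred nat) (i : nat) :
  ~~ B i -> (1 <= i <= n)%N ->
  reflect (exists2 b, round_winner f A i /\ round_winner f B b
             & (Xi f (pred2 i b) b < Xi f (pred2 i b) i)%N)
          (wins_two_round f A B i).
Proof.
move=> Bi hi; apply: (iffP hasP) => [[a ha] /hasP[b hb]|[b [wa wb] X]].
  move=> /and3P[wa wb /orP[/andP[/eqP ai X]|/andP[/eqP bi _]]].
    by subst a; exists b.
  by case/round_winnerP: wb => _; rewrite bi (negbTE Bi).
have [hb _ _] := round_winnerP _ _ _ _ _ wb.
exists i; first by rewrite mem_iota; lia.
apply/hasP; exists b; first by rewrite mem_iota; lia.
by rewrite wa wb /=; apply/orP; left; rewrite eqxx; exact: X.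
Qed.

Lemma wins_win_event (n m l : nat) (f : {ffun 'I_m -> 'I_n}) :
  ~~ odd n -> (2 <= l)%N -> (2 * l < n)%N ->
  separated n m f -> (forall j, f j != 0 :> nat) -> (forall j, f j != l :> nat) ->
  wins_two_round f (A1 n l) (B1 n l) 1 =
  win_event [ffun j => seed_class n l (f j)].
Proof.
move=> nE l2 ln sep f0 fl.
have dA := A1_dense _ _ nE l2 ln; have dB := B1_dense _ _ nE l2 ln.
have B1F : ~~ B1 n l 1 by rewrite /B1 A1E //; lia.
have XA : Xi f (A1 n l) 1 = hits [ffun j => seed_class n l (f j)] false.
  case: dA => h S0 S1 hS _; rewrite (Xi_first _ _ _ _ _ _ h) //.
  apply: eq_card => j; rewrite !inE ffunE seed_class_false ?(ltnW ln) //.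
  by have := f0 j; lia.
have XB : Xi f (B1 n l) l.+1 = hits [ffun j => seed_class n l (f j)] true.
  case: dB => h S0 S1 hS _; rewrite (Xi_first _ _ _ _ _ _ h) //.
  apply: eq_card => j; rewrite !inE ffunE seed_class_true.
  by have := f0 j; have := fl j; have := ltn_ord (f j); lia.
(* In the final, candidate 1 gets the seeds 1 and those above [l + 1]; once the seeds 1 and [l + 1]
   are excluded, this is the complement of the first [l] seeds. *)
have XF1 : Xi f (pred2 1%N l.+1) 1 =
    (m - hits [ffun j => seed_class n l (f j)] true)%N.
  rewrite (Xi_first _ _ _ _ 1 l.+1); [|split; lia| by []| by rewrite /= eqxx orbT
    | by move=> c _ /= /orP[] /eqP ->; lia].
  transitivity #|predC [pred j | [ffun j => seed_class n l (f j)] j == Some true]|.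
    apply: eq_card => j; rewrite !inE ffunE seed_class_true.
    by have := f0 j; have := fl j; have := ltn_ord (f j); lia.
  have := cardC [pred j | [ffun j => seed_class n l (f j)] j == Some true].
  by rewrite card_ord => /(canRL (addKn _)).
have XFl : Xi f (pred2 1%N l.+1) l.+1 =
    hits [ffun j => seed_class n l (f j)] true.
  rewrite /Xi; apply: eq_card => j; rewrite !inE ffunE.
  have sb := seed_bounds n m f j.
  have := f0 j; have := fl j => fl' f0'.
  rewrite seed_class_true.
  apply/votes_forP/idP.
    case=> _ _ /(_ 1%N ltac:(lia) isT).
    by have := cpos_cases n _ 1 sb; have := cpos_cases n _ l.+1 sb; lia.
  move=> fjl; split; [lia|by rewrite /= eqxx orbT|].
  move=> c hc /= /orP[] /eqP ->;
    by have := cpos_cases n _ 1 sb; have := cpos_cases n _ l.+1 sb; lia.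
apply/wins_two_roundP/idP => //; first by lia.
  case=> b [wA wB X].
  (* With at most one voter, a single vote could win a round. That voter's seed would win its own
     half: in [A1] it would be the excluded seed 1, in [B1] it is [b], and the voter then chooses
     [b] in the final too. *)
  have m1 : (1 < m)%N.
    case: (ltnP 1 m) => // m1.
    have Xm S c : (Xi f S c <= 1)%N.
      by apply: leq_trans m1; rewrite -[leqRHS](card_ord m) max_card.
    have vA := round_winner_unanimous _ _ _ _ _ wA (Xm _ _).
    have vB := round_winner_unanimous _ _ _ _ _ wB (Xm _ _).
    have /card_gt0P[j] : (0 < Xi f (pred2 1%N b) 1)%N by lia.
    rewrite !inE => vF.
    have sb := seed_bounds n m f j.
    have [As|As] := boolP (A1 n l (f j).+1).
      by have := votes_for_self _ _ _ _ sb As (vA j); have := f0 j; lia.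
    have Bs : B1 n l (f j).+1 by rewrite /B1 As andbT; lia.
    have bE := votes_for_self _ _ _ _ sb Bs (vB j).
    have sF : pred2 1%N b (f j).+1 by rewrite /= bE eqxx orbT.
    by have := votes_for_self _ _ _ _ sb sF vF; have := f0 j; lia.
  have XA2 : (2 <= Xi f (A1 n l) 1)%N.
    by rewrite leqNgt; apply/negP => h; have := round_winner_le1 _ _ _ _ _ wA h; lia.
  have XB2 : (2 <= Xi f (B1 n l) b)%N.
    by rewrite leqNgt; apply/negP => h; have := round_winner_le1 _ _ _ _ _ wB h; lia.
  have bl : b = l.+1.
    case: (eqVneq b l.+1) => // /eqP bl.
    by have := Xi_other_le1 _ _ _ _ _ _ _ sep dB bl; lia.
  subst b; rewrite XA in XA2; rewrite XB in XB2; rewrite XF1 XFl in X.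
  by rewrite /win_event; lia.
case/and3P => h1 h2 h3.
have [[_ _ _] A1_1 _ _ _] := dA; have [[_ _ _] Bl _ _ _] := dB.
exists l.+1; last by rewrite XF1 XFl; lia.
split; apply/round_winnerP; split=> //; try (by lia).
  move=> a ha Aa /eqP a1; rewrite XA.
  by have := Xi_other_le1 _ _ _ _ _ _ _ sep dA a1; lia.
move=> a ha Ba /eqP a1; rewrite XB.
by have := Xi_other_le1 _ _ _ _ _ _ _ sep dB a1; lia.
Qed.

(** * Product weights *)

Section ProductWeights.
Variables (R : realFieldType) (T : finType) (w : T -> R).
Hypothesis w_ge0 : forall t, 0 <= w t.
Hypothesis w_sum1 : \sum_t w t = 1.

Definition prodw {m} (h : {ffun 'I_m -> T}) : R := \prod_i w (h i).

Lemma prodw_ge0 {m} (h : {ffun 'I_m -> T}) : 0 <= prodw h.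
Proof. exact: prodr_ge0. Qed.

Lemma prodw_sum1 (m : nat) : \sum_(h : {ffun 'I_m -> T}) prodw h = 1.
Proof.
rewrite /prodw -(bigA_distr_bigA (fun (i : 'I_m) t => w t)) /=.
by rewrite big1 // => i _.
Qed.

(** Attach [Y] to the factor [i] and exchange sum and product; every other factor sums to 1. *)
Lemma prodw_sum_mul1 {m} (Y : T -> R) (i : 'I_m) :
  \sum_(h : {ffun 'I_m -> T}) prodw h * Y (h i) = \sum_t w t * Y t.
Proof.
transitivity (\sum_(h : {ffun 'I_m -> T})
    \prod_k (w (h k) * (if k == i then Y (h k) else 1))).
  apply: eq_bigr => h _; rewrite big_split /= -big_mkcond /=.
  by rewrite big_pred1_eq.
rewrite -(bigA_distr_bigA (fun (k : 'I_m) t => w t * if k == i then Y t else 1)) /=.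
rewrite (bigD1 i) //= eqxx [X in _ * X]big1 ?mulr1 // => k /negPf ->.
by under eq_bigr do rewrite mulr1.
Qed.

Lemma prodw_sum_mul2 {m} (Y : T -> R) (i j : 'I_m) : i != j ->
  \sum_(h : {ffun 'I_m -> T}) prodw h * (Y (h i) * Y (h j)) =
  (\sum_t w t * Y t) ^+ 2.
Proof.
move=> ij.
transitivity (\sum_(h : {ffun 'I_m -> T})
    \prod_k (w (h k) * (if (k == i) || (k == j) then Y (h k) else 1))).
  apply: eq_bigr => h _; rewrite big_split /= -big_mkcond /=; congr (_ * _).
  rewrite (bigD1 i) ?eqxx //=; congr (_ * _); rewrite (bigD1 j) ?eqxx ?orbT //=.
    by rewrite big1 ?mulr1 // => k; case: (k == i); case: (k == j).
  by rewrite eq_sym.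
rewrite -(bigA_distr_bigA
  (fun (k : 'I_m) t => w t * if (k == i) || (k == j) then Y t else 1)) /=.
rewrite (bigD1 i) //= (bigD1 j) 1?eq_sym //= !eqxx orbT /= [X in _ * (_ * X)]big1 ?mulr1 ?expr2 //.
by move=> k /andP[/negPf -> /negPf ->]; under eq_bigr do rewrite mulr1.
Qed.

(** After expanding the square, the off-diagonal terms vanish by independence and centring; each
    diagonal term is one second moment. *)
Lemma prodw_variance (m : nat) (Y : T -> R) : \sum_t w t * Y t = 0 ->
  \sum_(h : {ffun 'I_m -> T}) prodw h * (\sum_i Y (h i)) ^+ 2 =
  m%:R * \sum_t w t * Y t ^+ 2.
Proof.
move=> Y0.
transitivity (\sum_(i < m) \sum_(j < m)
    \sum_(h : {ffun 'I_m -> T}) prodw h * (Y (h i) * Y (h j))).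
  rewrite exchange_big /= (eq_bigr _ (fun i _ => exchange_big _ _ _ _ _ _)) /=.
  rewrite exchange_big /=; apply: eq_bigr => h _.
  rewrite expr2 big_distrlr /= mulr_sumr exchange_big /=.
  by apply: eq_bigr => i _; rewrite mulr_sumr; apply: eq_bigr => j _; rewrite (mulrC (Y _)).
rewrite -[in m%:R](card_ord m) mulr_natl -sumr_const; apply: eq_bigr => i _.
rewrite (bigD1 i) //= [X in _ + X]big1 ?addr0; last first.
  by move=> j ji; rewrite prodw_sum_mul2 1?eq_sym // Y0 expr0n.
rewrite -(prodw_sum_mul1 (fun t => Y t ^+ 2) i).
by apply: eq_bigr => h _; rewrite expr2.
Qed.

Definition prw {m} (P : pred {ffun 'I_m -> T}) : R := \sum_(h | P h) prodw h.

Lemma prw_chebyshev (m : nat) (A : pred T) (q eps : R) (P : pred {ffun 'I_m -> T}) :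
  \sum_(t | A t) w t = q -> 0 < eps ->
  (forall h, P h -> eps <= `| #|[pred i | A (h i)]|%:R - m%:R * q |) ->
  prw P <= m%:R / eps ^+ 2.
Proof.
move=> qE eps0 hP.
pose Y t : R := (A t)%:R - q.
have q01 : 0 <= q <= 1.
  rewrite -qE sumr_ge0 //= -w_sum1 [leRHS](bigID A) /= lerDl.
  by apply: sumr_ge0.
have Y0 : \sum_t w t * Y t = 0.
  under eq_bigr do rewrite mulrBr.
  rewrite sumrB -mulr_suml w_sum1 mul1r -qE [in X in _ - X]big_mkcond /=.
  apply/eqP; rewrite subr_eq0; apply/eqP; apply: eq_bigr => t _.
  by case: (A t); rewrite ?mulr1 ?mulr0.
(* The crude bound [|Y| <= 1] replaces the exact variance [q * (1 - q)]. *)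
have Y2 : \sum_t w t * Y t ^+ 2 <= 1.
  rewrite -w_sum1; apply: ler_sum => t _; rewrite -[leRHS]mulr1.
  by apply: ler_wpM2l => //; case/andP: q01 => q0 q1; rewrite /Y expr2; case: (A t) => /=; nra.
rewrite ler_pdivlMr ?exprn_gt0 //.
apply: le_trans (_ : m%:R * \sum_t w t * Y t ^+ 2 <= _); last first.
  by rewrite -[leRHS]mulr1; apply: ler_wpM2l.
rewrite -prodw_variance // /prw mulr_suml big_mkcond /=.
apply: ler_sum => h _; case: ifPn => [Ph|_]; last first.
  by rewrite mulr_ge0 ?prodw_ge0 ?sqr_ge0.
apply: ler_wpM2l; first exact: prodw_ge0.
have -> : \sum_i Y (h i) = #|[pred i | A (h i)]|%:R - m%:R * q.
  rewrite /Y sumrB sumr_const card_ord mulr_natl; congr (_ - _).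
  rewrite -sum1_card natr_sum [RHS]big_mkcond /=; apply: eq_bigr => i _.
  by rewrite inE; case: (A _).
by rewrite -[leRHS]real_normK ?num_real // ler_pXn2r ?nnegrE ?hP // ltW.
Qed.

Lemma prw_le {m} (P Q : pred {ffun 'I_m -> T}) :
  (forall h, P h -> Q h) -> prw P <= prw Q.
Proof.
move=> PQ; rewrite /prw [leLHS]big_mkcond [leRHS]big_mkcond; apply: ler_sum => h _.
by case: ifPn => [/PQ -> //|_]; case: ifP => // _; exact: prodw_ge0.
Qed.

Lemma prwU {m} (P Q : pred {ffun 'I_m -> T}) : prw (predU P Q) <= prw P + prw Q.
Proof.
rewrite /prw [leLHS]big_mkcond [X in X + _]big_mkcond [X in _ + X]big_mkcond.
rewrite -big_split; apply: ler_sum => h _ /=.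
by case: (P h); case: (Q h); rewrite ?addr0 ?add0r // lerDl prodw_ge0.
Qed.

Lemma prwC {m} (P : pred {ffun 'I_m -> T}) : prw P = 1 - prw (predC P).
Proof. by rewrite -(prodw_sum1 m) (bigID P) /= addrK. Qed.

Lemma prw_ge0 {m} (P : pred {ffun 'I_m -> T}) : 0 <= prw P.
Proof. by apply: sumr_ge0 => h _; exact: prodw_ge0. Qed.
End ProductWeights.

(* The push-forward of the uniform measure along a letterwise map. *)
Lemma card_letterwise (R : realFieldType) (U T : finType) (m : nat) (g : U -> T)
    (P : pred {ffun 'I_m -> T}) : (0 < #|U|)%N ->
  #|[pred f : {ffun 'I_m -> U} | P [ffun j => g (f j)]]|%:R / (#|U| ^ m)%:R =
  prw R T (fun t => #|[pred u | g u == t]|%:R / #|U|%:R) P :> R.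
Proof.
move=> U0; rewrite /prw /prodw -sum1_card natr_sum.
rewrite (partition_big (fun f : {ffun 'I_m -> U} => [ffun j => g (f j)]) P) //=.
rewrite mulr_suml; apply: eq_bigr => h Ph.
rewrite big_split /= prodr_const card_ord natrX -exprVn; congr (_ * _).
(* The indicator that [f] maps to [h] is a product of letterwise indicators, so the size of the
   fibre factorises. *)
transitivity (\sum_(f : {ffun 'I_m -> U}) \prod_i (g (f i) == h i)%:R : R).
  rewrite big_mkcond /=; apply: eq_bigr => f _; rewrite inE.
  case: (eqVneq [ffun j => g (f j)] h) => [gh|neq].
    by rewrite gh Ph big1 // => i _; rewrite -gh ffunE eqxx.
  rewrite andbF; have [i /eqP hi|hh] := pickP (fun i => g (f i) != h i).
    by rewrite (bigD1 i) //=; move/eqP/negPf: hi => ->; rewrite mul0r.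
  case/eqP: neq; apply/ffunP => i; rewrite ffunE.
  by apply/eqP; have := hh i; case: eqP.
rewrite -(bigA_distr_bigA (fun i u => (g u == h i)%:R)) /=.
apply: eq_bigr => i _; rewrite -sum1_card natr_sum [RHS]big_mkcond /=.
by apply: eq_bigr => u _; rewrite inE; case: eqP.
Qed.

(* Overwriting the coordinate [j] with an arbitrary value is injective on
   [S * 'I_n]. *)
Lemma card_determined_coord (m n : nat) (j : 'I_m) (S : {set {ffun 'I_m -> 'I_n}}) :
  (forall f f' : {ffun 'I_m -> 'I_n}, f \in S -> f' \in S ->
     (forall i, i != j -> f i = f' i) -> f j = f' j) ->
  (#|S| * n <= n ^ m)%N.
Proof.
move=> det.
pose F (p : {ffun 'I_m -> 'I_n} * 'I_n) : {ffun 'I_m -> 'I_n} :=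
  [ffun i => if i == j then p.2 else p.1 i].
have Finj : {in finset.setX S [set: 'I_n]%SET &, injective F}.
  move=> [f u] [f' u']; rewrite !inE /= !andbT => fS fS' /ffunP FF.
  have off i : i != j -> f i = f' i.
    by move=> ij; have := FF i; rewrite !ffunE (negPf ij).
  have -> : u = u' by have := FF j; rewrite !ffunE eqxx.
  congr (_, _); apply/ffunP => i; case: (eqVneq i j) => [->|]; last exact: off.
  exact: det.
have := card_in_imset Finj; rewrite cardsX finset.cardsT card_ord => <-.
by rewrite (leq_trans (max_card _)) // card_ffun !card_ord.
Qed.

(** * The limiting event *)

Lemma hits_sum_le (m : nat) (h : {ffun 'I_m -> option bool}) :
  (hits h true + hits h false <= m)%N.
Proof.
rewrite -[leqRHS](card_ord m) -(cardC [pred j | h j == Some true]) leq_add2l.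
by apply: subset_leq_card; apply/fintype.subsetP => j; rewrite !inE => /eqP ->.
Qed.

(** Choose the set [D] of voters of class [Some true], then the set [E] of those of class
    [Some false] inside its complement. For fixed [D], the maps [F] and [G] are mutually inverse. *)
Lemma card_hits (m s t : nat) :
  #|[pred h : {ffun 'I_m -> option bool} | (hits h true == s) && (hits h false == t)]| =
  ('C(m, s) * 'C(m - s, t))%N.
Proof.
rewrite -sum1_card.
rewrite (partition_big (fun h : {ffun 'I_m -> option bool} =>
   finset (fun j => h j == Some true)) (fun D => #|D| == s)); last first.
  by move=> h /andP[/eqP <- _]; rewrite cardsE.
rewrite (eq_bigr (fun=> 'C(m - s, t))) => [|D /eqP Ds].
  rewrite sum_nat_const; congr (_ * _)%N.
  by have := card_draws 'I_m s; rewrite card_ord cardsE.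
have <- : #|~: D| = (m - s)%N by rewrite cardsCs finset.setCK card_ord Ds.
rewrite -cards_draws sum1dep_card.
pose F (h : {ffun 'I_m -> option bool}) := finset (fun j => h j == Some false).
pose G (E : {set 'I_m}) : {ffun 'I_m -> option bool} :=
  [ffun j => if j \in D then Some true else if j \in E then Some false else None].
rewrite -(card_in_imset (f := F)).
  apply: eq_card => E; rewrite !inE; apply/imsetP/andP.
    case=> h; rewrite inE => /andP[/andP[_ /eqP ht] /eqP hD] ->; split.
      by apply/fintype.subsetP => j; rewrite -hD !inE => /eqP ->.
    by rewrite /F cardsE -ht.
  case=> /fintype.subsetP ED /eqP Et; exists (G E).
    rewrite inE -andbA; apply/and3P; split.
    - rewrite -Ds; apply/eqP; apply: eq_card => j; rewrite !inE ffunE.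
      by case: (j \in D) => //; case: (j \in E).
    - rewrite -Et; apply/eqP; apply: eq_card => j; rewrite !inE ffunE.
      have := ED j; rewrite inE.
      by case: (j \in D); case: (j \in E) => // /(_ isT).
    - apply/eqP/finset.setP => j; rewrite !inE ffunE.
      by case: (j \in D) => //; case: (j \in E).
  apply/finset.setP => j; rewrite !inE ffunE.
  have := ED j; rewrite inE.
  by case: (j \in D); case: (j \in E) => // /(_ isT).
move=> h h'; rewrite !inE => /andP[_ /eqP hD] /andP[_ /eqP h'D] /finset.setP Fhh'.
apply/ffunP => j; have /finset.setP/(_ j) := etrans hD (esym h'D).
have := Fhh' j; rewrite !inE.
by case: (h j) => [[]|]; case: (h' j) => [[]|].
Qed.

(** The law of the class of a uniform point of the circle when both arcs have length [x]. *)
Definition trinomial_weight {R : pzRingType} (x : R) (o : option bool) : R :=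
  if o is Some _ then x else 1 - 2 * x.

Section Trinomial.
Variables (R : realType) (x : R).
Notation w := (trinomial_weight x).

Lemma sum_option_bool (F : option bool -> R) :
  \sum_o F o = F (Some true) + F (Some false) + F None.
Proof.
rewrite (bigD1 (Some true)) //= (bigD1 (Some false)) //= (bigD1 None) //=.
by rewrite big1 ?addr0 ?addrA // => -[[]|].
Qed.

Lemma trinomial_weight_sum1 : \sum_o w o = 1.
Proof. by rewrite sum_option_bool /=; ring. Qed.

Lemma prodw_trinomial (m : nat) (h : {ffun 'I_m -> option bool}) :
  prodw R _ w h = x ^+ (hits h true + hits h false) *
    (1 - 2 * x) ^+ (m - hits h true - hits h false).
Proof.
rewrite /prodw (bigID (fun i => h i == Some true)) /=.
rewrite (eq_bigr (fun=> x)) => [|i /eqP -> //].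
rewrite prodr_const (bigID (fun i => h i == Some false)) /=.
rewrite (eq_bigr (fun=> x)) => [|i /andP[_ /eqP ->] //].
rewrite [X in _ * (_ * X)](eq_bigr (fun=> 1 - 2 * x))
  => [|i /andP[/eqP n1 /eqP n2]]; last by case: (h i) n1 n2 => [[]|].
rewrite !prodr_const mulrA -exprD.
have E : #|[pred i | (h i != Some true) && (h i == Some false)]| = hits h false.
  by apply: eq_card => i; rewrite !inE; case: (h i) => [[]|].
have -> : (m - hits h true - hits h false)%N =
    #|[pred i | (h i != Some true) && (h i != Some false)]|.
  rewrite -subnDA; apply: (canLR (addKn _)); rewrite -[LHS](card_ord m).
  rewrite -(cardC [pred j | h j == Some true]) -addnA; congr addn.
  rewrite -(cardID [pred j | h j == Some false]) -E; congr addn;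
    by apply: eq_card => i; rewrite !inE // andbC.
by congr (_ ^+ (_ + _) * _).
Qed.

(** Words are grouped by their two hit numbers; the multinomial coefficient is
    ['C(m, s) * 'C(m - s, t)]. *)
Lemma p_infE (m : nat) : p_inf m x = prw R _ w (@win_event m).
Proof.
transitivity (\sum_(2 <= s < ((m - 1) %/ 2).+1) \sum_(2 <= t < (m - s).+1)
    \sum_(h : {ffun 'I_m -> option bool} | (hits h true == s) && (hits h false == t))
      prodw R _ w h).
  rewrite /p_inf big_nat_cond [RHS]big_nat_cond; apply: eq_bigr => s /andP[hs _].
  rewrite big_nat_cond [RHS]big_nat_cond; apply: eq_bigr => t /andP[ht _].
  rewrite (eq_bigr (fun=> x ^+ (s + t) * (1 - 2 * x) ^+ (m - s - t))); last first.
    by move=> h /andP[/eqP <- /eqP <-]; rewrite prodw_trinomial.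
  rewrite sumr_const card_hits -mulrA -[RHS]mulr_natl; congr (_ * _).
  have h1 := @bin_fact m s ltac:(lia).
  have h2 := @bin_fact (m - s) t ltac:(lia).
  apply: (canLR (mulfK _)); last by rewrite -natrM -h1 -h2; congr (_%:R); lia.
  by rewrite pnatr_eq0 -lt0n !muln_gt0 !fact_gt0.
rewrite /prw [RHS]big_mkcond /=.
transitivity (\sum_(h : {ffun 'I_m -> option bool})
  \sum_(2 <= s < ((m - 1) %/ 2).+1 | s == hits h true)
  \sum_(2 <= t < (m - s).+1 | t == hits h false) prodw R _ w h); last first.
  apply: eq_bigr => h _; rewrite !big_nat1_eq /win_event.
  (* The upper limit for [s] encodes [2 * s < m], and the one for [t] holds for every word. *)
  have := hits_sum_le m h => hm.
  have -> : (1 < hits h true < ((m - 1) %/ 2).+1)%N =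
     (1 < hits h true)%N && (2 * hits h true < m)%N by lia.
  case: (ltnP 1 (hits h true)) => h1 /=; last by rewrite andbF.
  case: (ltnP (2 * hits h true) m) => h2 /=; last by rewrite andbF.
  rewrite andbT; congr (if _ then _ else _); lia.
rewrite [RHS](eq_bigr _ (fun h _ => big_mkcond _ _)) exchange_big /=.
apply: eq_bigr => s _; rewrite [LHS](eq_bigr _ (fun t _ => big_mkcond _ _)) exchange_big /=.
apply: eq_bigr => h _; rewrite eq_sym; case: (s == _) => /=; last by rewrite big1.
by rewrite [RHS]big_mkcond; apply: eq_bigr => t _; rewrite eq_sym.
Qed.
End Trinomial.

(** * Bounds on the limiting probability *)

Section WinProbability.
Variables (R : realType) (x : R).
Hypothesis x_bounds : 0 <= x <= 1 / 2.

Lemma trinomial_weight_ge0 o : 0 <= trinomial_weight x o.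
Proof. by case/andP: x_bounds => x0 x1; case: o => [_|] /=; lra. Qed.

Lemma p_inf_le1 (m : nat) : p_inf m x <= 1.
Proof.
rewrite p_infE (prwC _ _ _ (trinomial_weight_sum1 _ x)) gerBl.
exact: prw_ge0 trinomial_weight_ge0 _ _.
Qed.

(** Chebyshev for each arc with deviation [m * d / 2] costs [4 / (m * d ^ 2)] twice. The bound
    depends on [x] only through [d], which lets the parameter vary with [m]. *)
Lemma p_inf_ge (m : nat) (d : R) : 0 < d -> d <= x <= 1 / 2 - d ->
  2 <= m%:R * d -> 1 - 8 / (m%:R * d ^+ 2) <= p_inf m x.
Proof.
move=> d0 /andP[dx xd] md.
have m0 : 0 < m%:R :> R by rewrite -(pmulr_lgt0 _ d0); lra.
pose P b (h : {ffun 'I_m -> option bool}) :=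
  m%:R * d / 2 <= `|(hits h b)%:R - m%:R * x|.
have PE b : prw R _ (trinomial_weight x) (P b) <= 4 / (m%:R * d ^+ 2).
  have -> : 4 / (m%:R * d ^+ 2) = m%:R / (m%:R * d / 2) ^+ 2.
    by field; rewrite !gt_eqF.
  apply: (prw_chebyshev _ _ _ trinomial_weight_ge0 (trinomial_weight_sum1 _ x)
    _ (pred1 (Some b)) x) => //.
    by rewrite big_pred1_eq.
  by rewrite divr_gt0 ?mulr_gt0.
rewrite p_infE (prwC _ _ _ (trinomial_weight_sum1 _ x)) lerD2l lerN2.
apply: le_trans (_ : prw R _ (trinomial_weight x) (predU (P true) (P false)) <= _).
  apply: prw_le => [t|h]; first exact: trinomial_weight_ge0.
  (* A count of at most 1 is at most [m * d / 2], while the mean is at least [m * d]; a count of at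
     least [m / 2] exceeds the mean by at least [m * d]. *)
  rewrite /= /win_event !negb_and -!leqNgt /P => /or3P[h1|h1|h1]; apply/orP.
  - right; rewrite ler_normr; apply/orP; right.
    have h1' : (hits h false)%:R <= 1%:R :> R by rewrite ler_nat.
    by nra.
  - left; rewrite ler_normr; apply/orP; right.
    have h1' : (hits h true)%:R <= 1%:R :> R by rewrite ler_nat.
    by nra.
  - left; rewrite ler_normr; apply/orP; left.
    have h1' : m%:R <= 2 * (hits h true)%:R :> R by rewrite -natrM ler_nat.
    by nra.
apply: le_trans (prwU _ _ _ trinomial_weight_ge0 _ _) _.
have := PE true; have := PE false.
have -> : 8 / (m%:R * d ^+ 2) = 4 / (m%:R * d ^+ 2) + 4 / (m%:R * d ^+ 2) :> R.
  by rewrite -mulrDl; congr (_ / _); lra.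
by move=> h1 h2; apply: lerD.
Qed.
End WinProbability.

(** * Exact law of the seed classes and rarity of collisions *)

Lemma card_seed_class (n l : nat) (o : option bool) : (2 * l <= n)%N ->
  #|[pred u : 'I_n | seed_class n l u == o]| = (if o is Some _ then l else n - 2 * l)%N.
Proof.
move=> ln.
have lt_card k : (k <= n)%N -> #|[pred u : 'I_n | (u < k)%N]| = k.
  move=> kn; rewrite -sum1_card -[RHS]card_ord -[in RHS]sum1_card.
  by rewrite (big_ord_widen n (fun=> 1%N) kn); apply: eq_bigl => u; rewrite inE.
have cT : #|[pred u : 'I_n | seed_class n l u == Some true]| = l.
  rewrite -[RHS]lt_card; last by lia.
  by apply: eq_card => u; rewrite !inE seed_class_true.
have cF : #|[pred u : 'I_n | seed_class n l u == Some false]| = l.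
  have := cardC [pred u : 'I_n | (u < n - l)%N]; rewrite card_ord lt_card ?leq_subr //.
  have -> : #|predC [pred u : 'I_n | (u < n - l)%N]| =
      #|[pred u : 'I_n | seed_class n l u == Some false]|.
    by apply: eq_card => u; rewrite !inE seed_class_false // -leqNgt.
  by move: #|_| => c; lia.
case: o => [[]|] //.
have := cardC [pred u : 'I_n | seed_class n l u == Some true].
rewrite card_ord -(cardID [pred u : 'I_n | seed_class n l u == Some false] (predC _)) cT.
have -> : #|[predI predC [pred u : 'I_n | seed_class n l u == Some true] &
    [pred u : 'I_n | seed_class n l u == Some false]]| = l.
  rewrite -[RHS]cF; apply: eq_card => u; rewrite !inE.
  by case: (seed_class n l u) => [[]|].
have -> : #|[predD predC [pred u : 'I_n | seed_class n l u == Some true] &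
    [pred u : 'I_n | seed_class n l u == Some false]]| =
    #|[pred u : 'I_n | seed_class n l u == None]|.
  by apply: eq_card => u; rewrite !inE; case: (seed_class n l u) => [[]|].
by move: #|_| => c; lia.
Qed.

(** The class of a uniform seed follows the trinomial law with parameter [l / n] exactly, so passing
    to [p_inf] costs no error here. *)
Lemma card_win_event (R : realType) (n m l : nat) : (0 < n)%N -> (2 * l <= n)%N ->
  #|[pred f : {ffun 'I_m -> 'I_n} | win_event [ffun j => seed_class n l (f j)]]|%:R
    / (n ^ m)%:R = p_inf m (l%:R / n%:R) :> R.
Proof.
move=> n0 ln.
have wE : (fun o => #|[pred u : 'I_n | seed_class n l u == o]|%:R / n%:R) =
    trinomial_weight (l%:R / n%:R : R).
  apply/funext => o; rewrite card_seed_class //; case: o => //=.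
  have n0' : n%:R != 0 :> R by rewrite pnatr_eq0 -lt0n.
  by rewrite natrB // natrM mulrBl divff //; field.
have := card_letterwise R 'I_n _ m (seed_class n l) (@win_event m).
by rewrite !card_ord p_infE -wE; apply.
Qed.

Lemma card_exists_le (I U : finType) (Q : I -> pred U) (c : nat) :
  (forall i, #|[pred u | Q i u]| <= c)%N ->
  (#|[pred u | [exists i, Q i u]]| <= #|I| * c)%N.
Proof.
move=> Qc; rewrite -sum_nat_const.
apply: leq_trans (_ : \sum_i #|[pred u | Q i u]| <= _)%N; last exact: leq_sum.
under eq_bigr do rewrite -sum1_card big_mkcond.
rewrite exchange_big -sum1_card big_mkcond /=; apply: leq_sum => u _.
rewrite inE; case: existsP => // -[i Qi].
by rewrite (bigD1 i) //= inE Qi leq_addr.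
Qed.

Lemma card_predU_le (T : finType) (P Q : pred T) : (#|predU P Q| <= #|P| + #|Q|)%N.
Proof.
rewrite -cardUI; apply: leq_trans (leq_addr _ _).
by apply/eq_leq/eq_card => t; rewrite !inE.
Qed.

(** The exceptional event; the 0-based values 0 and [l] are the seeds 1 and [l + 1]. *)
Definition seed_collision {n m} (l : nat) (f : {ffun 'I_m -> 'I_n}) : bool :=
  [|| [exists p : 'I_m * 'I_m, (p.1 != p.2) && (f p.1 == f p.2)],
      [exists p : 'I_m * 'I_m, (p.1 != p.2) && ((f p.1).+1 == f p.2 :> nat)],
      [exists j, f j == 0 :> nat] | [exists j, f j == l :> nat]].

(** For fixed voters, each clause determines one coordinate from the others and so holds for at most
    a fraction [1 / n] of the maps. The union bound runs twice over pairs and twice over single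
    voters. *)
Lemma card_seed_collision (n m l : nat) :
  (#|[pred f : {ffun 'I_m -> 'I_n} | seed_collision l f]| * n <=
   (2 * m ^ 2 + 2 * m) * n ^ m)%N.
Proof.
case: (posnP n) => [->|n0]; first by rewrite muln0.
pose c := (n ^ m %/ n)%N.
have det (j : 'I_m) (Q : pred {ffun 'I_m -> 'I_n}) :
    (forall f f' : {ffun 'I_m -> 'I_n}, Q f -> Q f' ->
       (forall i, i != j -> f i = f' i) -> f j = f' j) ->
    (#|[pred f | Q f]| <= c)%N.
  move=> Qdet; rewrite leq_divRL // -[X in (X * n)%N]cardsE.
  by apply: (card_determined_coord _ _ j) => f f'; rewrite !inE; exact: Qdet.
have c1 : (#|[pred f : {ffun 'I_m -> 'I_n} |
    [exists p : 'I_m * 'I_m, (p.1 != p.2) && (f p.1 == f p.2)]]| <= m * m * c)%N.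
  have := card_exists_le ('I_m * 'I_m)%type _
    (fun p (f : {ffun 'I_m -> 'I_n}) => (p.1 != p.2) && (f p.1 == f p.2)) c.
  rewrite card_prod card_ord; apply=> -[i j] /=; apply: (det j) => f f'.
  by move=> /andP[ij /eqP <-] /andP[_ /eqP <-] /(_ i ij).
have c2 : (#|[pred f : {ffun 'I_m -> 'I_n} |
    [exists p : 'I_m * 'I_m, (p.1 != p.2) && ((f p.1).+1 == f p.2 :> nat)]]|
    <= m * m * c)%N.
  have := card_exists_le ('I_m * 'I_m)%type _
    (fun p (f : {ffun 'I_m -> 'I_n}) =>
       (p.1 != p.2) && ((f p.1).+1 == f p.2 :> nat)) c.
  rewrite card_prod card_ord; apply=> -[i j] /=; apply: (det j) => f f'.
  move=> /andP[ij /eqP fj] /andP[_ /eqP f'j] /(_ i ij) fi.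
  by apply: val_inj; rewrite /= -fj -f'j fi.
have c3 k : (#|[pred f : {ffun 'I_m -> 'I_n} | [exists j, f j == k :> nat]]| <= m * c)%N.
  have := card_exists_le 'I_m _ (fun j (f : {ffun 'I_m -> 'I_n}) => f j == k :> nat) c.
  rewrite card_ord; apply=> j; apply: (det j) => f f' /eqP fj /eqP f'j _.
  by apply: val_inj; rewrite /= fj f'j.
have c4 : (#|[pred f : {ffun 'I_m -> 'I_n} | seed_collision l f]| <=
    (2 * m ^ 2 + 2 * m) * c)%N.
  have := c3 0%N; have := c3 l; move: c1 c2.
  set P1 := [pred f | _]; set P2 := [pred f | _].
  set P3 := [pred f | _]; set P4 := [pred f | _] => c1 c2 c3' c4.
  apply: leq_trans (_ : #|P1| + (#|P2| + (#|P4| + #|P3|)) <= _)%N; last by nia.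
  apply: leq_trans (card_predU_le _ P1 (predU P2 (predU P4 P3))) _; rewrite leq_add2l.
  apply: leq_trans (card_predU_le _ P2 (predU P4 P3)) _; rewrite leq_add2l.
  exact: card_predU_le.
apply: leq_trans (leq_mul c4 (leqnn n)) _; rewrite -mulnA leq_mul2l /c.
by rewrite leq_divM orbT.
Qed.

Lemma no_collision_separated (n m l : nat) (f : {ffun 'I_m -> 'I_n}) :
  ~~ seed_collision l f ->
  [/\ separated n m f, forall j, f j != 0 :> nat & forall j, f j != l :> nat].
Proof.
rewrite /seed_collision !negb_or !negb_exists.
case/and4P => /forallP h1 /forallP h2 /forallP h3 /forallP h4; split=> // i j ij.
by have := h1 (i, j); have := h2 (i, j); rewrite /= ij.
Qed.

Lemma p1_approx (R : realType) (n m l : nat) :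
  ~~ odd n -> (2 <= l)%N -> (2 * l < n)%N ->
  `|p1 n m l - p_inf m (l%:R / n%:R)| <= 4 * (m%:R / Num.sqrt n%:R) ^+ 2 :> R.
Proof.
move=> nE l2 ln; have n0 : (0 < n)%N by lia.
have nR : 0 < n%:R :> R by rewrite ltr0n.
rewrite -card_win_event ?(ltnW ln) // /p1 cardsE -mulrBl normrM.
rewrite [X in _ * X]gtr0_norm ?invr_gt0 ?ltr0n ?expn_gt0 ?n0 //.
rewrite ler_pdivrMr ?ltr0n ?expn_gt0 ?n0 // expr_div_n sqr_sqrtr ?ler0n //.
pose W : pred {ffun 'I_m -> 'I_n} := [pred f | wins_two_round f (A1 n l) (B1 n l) 1].
pose E : pred {ffun 'I_m -> 'I_n} :=
  [pred f : {ffun 'I_m -> 'I_n} | win_event [ffun j => seed_class n l (f j)]].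
pose C : pred {ffun 'I_m -> 'I_n} := [pred f | seed_collision l f].
(* Off the collisions the two events agree, so their cardinals differ by at most [#|C|]. *)
have WE f : ~~ C f -> W f = E f.
  by move=> /no_collision_separated[sep f0 fl]; exact: wins_win_event.
have sub (P Q : pred {ffun 'I_m -> 'I_n}) : (forall f, ~~ C f -> P f -> Q f) ->
    (#|P| <= #|Q| + #|C|)%N.
  move=> PQ; apply: leq_trans (_ : #|predU Q C| <= _)%N; last exact: card_predU_le.
  apply: subset_leq_card; apply/fintype.subsetP => f Pf; rewrite !inE.
  by case: (boolP (C f)) => Cf; rewrite ?orbT // (PQ f Cf Pf).
have WC : (#|W| <= #|E| + #|C|)%N by apply: sub => f Cf; rewrite WE.
have EC : (#|E| <= #|W| + #|C|)%N by apply: sub => f Cf; rewrite WE.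
have cC : (#|C| * n <= (2 * m ^ 2 + 2 * m) * n ^ m)%N := card_seed_collision n m l.
apply: le_trans (_ : #|C|%:R <= _).
  rewrite -(ler_nat R) natrD in WC; rewrite -(ler_nat R) natrD in EC.
  by rewrite ler_distlC; apply/andP; split; rewrite ?lerBlDr.
rewrite mulrA mulrAC ler_pdivlMr // -!(natrM, natrX) ler_nat.
(* Here [m <= m ^ 2] absorbs the linear term into [4 * m ^ 2]. *)
apply: leq_trans cC _; rewrite leq_mul2r; apply/orP; right; nia.
Qed.

(** * Limits *)

Local Open Scope classical_set_scope.
Local Open Scope ring_scope.

(** For fixed [m] it is a polynomial in the parameter. *)
Lemma p_inf_continuous (R : realType) (m : nat) : continuous (@p_inf R m).
Proof.
pose p : {poly R} := \sum_(2 <= s < ((m - 1) %/ 2).+1) \sum_(2 <= t < (m - s).+1)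
  ((m`!)%:R / ((s`! * t`! * (m - s - t)`!)%N)%:R)%:P * 'X ^+ (s + t)
    * (1 - 2%:P * 'X) ^+ (m - s - t).
suff -> : p_inf m = horner p by exact: continuous_horner.
apply/funext => x; rewrite /p_inf horner_sum; apply: eq_bigr => s _.
rewrite horner_sum; apply: eq_bigr => t _.
by rewrite !hornerE.
Qed.

Lemma p_inf_cvg1 (R : realType) (u : nat -> nat) (x : nat -> R) (eta : R) :
  0 < eta < 1 / 2 -> (u k)%:R @[k --> \oo] --> (+oo : set_system R) ->
  x k @[k --> \oo] --> eta -> p_inf (u k) (x k) @[k --> \oo] --> (1 : R).
Proof.
move=> /andP[eta0 eta1] /cvgryPge u_oo /cvgrPdist_le x_eta.
(* With [d] at most half the distance from [eta] to 0 and to 1/2, every [x k] within [d] of [eta]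
   stays [d] away from both ends. *)
have [d [d0 d1 d2]] : exists d, [/\ 0 < d, 2 * d <= eta & 2 * d <= 1 / 2 - eta].
  exists (Num.min eta (1 / 2 - eta) / 2); rewrite [2 * _]mulrC divfK // !ge_min !lexx orbT.
  by split=> //; rewrite divr_gt0 // lt_min eta0 subr_gt0.
apply/cvgrPdist_le => e e0.
near=> k.
have xk : `|eta - x k| <= d by near: k; exact: x_eta d d0.
(* The first threshold is the size condition of [p_inf_ge]; the second brings its error term below
   [e]. *)
have uk1 : 2 / d <= (u k)%:R by near: k; exact: u_oo.
have uk2 : 8 / (d ^+ 2 * e) <= (u k)%:R by near: k; exact: u_oo.
have {}xk : d <= x k <= 1 / 2 - d by move: xk; rewrite ler_distlC; lra.
have x01 : 0 <= x k <= 1 / 2 by lra.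
have := p_inf_le1 R (x k) x01 (u k).
have := p_inf_ge R (x k) x01 (u k) d d0 xk.
rewrite -ler_pdivrMr // => /(_ uk1) lo hi.
rewrite ger0_norm ?subr_ge0 //.
have u0 : 0 < (u k)%:R :> R by apply: lt_le_trans uk1; rewrite divr_gt0.
suff : 8 / ((u k)%:R * d ^+ 2) <= e by lra.
rewrite ler_pdivrMr ?mulr_gt0 ?exprn_gt0 //.
move: uk2; rewrite ler_pdivrMr ?mulr_gt0 ?exprn_gt0 //.
by move/le_trans; apply; rewrite le_eqVlt; apply/orP; left; apply/eqP; ring.
Unshelve. all: by end_near. Qed.

Lemma cvg0_dominated (R : realType) (u v : nat -> R) :
  (forall k, `|v k| <= `|u k|) -> u k @[k --> \oo] --> (0 : R) ->
  v k @[k --> \oo] --> (0 : R).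
Proof.
move=> vu /cvgrPdistC_le u0; apply/cvgrPdistC_le => e e0.
near=> k; rewrite subr0; apply: le_trans (vu k) _; rewrite -[u k]subr0.
by near: k; exact: u0.
Unshelve. all: by end_near. Qed.

(* The even n >= 6 are enumerated as n = 2k+6, and n -> oo means k -> oo.
   m(n), l_n are given as functions nat -> nat; only their values at even
   n >= 6 are constrained / used. *)
Theorem mainTheorem10 (R : realType) (m l : nat -> nat) (eta : R) :
  (0 < eta < 1/2) ->
  (forall n, (6 <= n)%N -> ~~ odd n -> (0 < m n)%N) ->
  ((m (2 * k + 6)%N)%:R / Num.sqrt ((2 * k + 6)%N)%:R : R)
     @[k --> \oo] --> (0 : R) ->
  (forall n, (6 <= n)%N -> ~~ odd n -> (2 <= l n)%N /\ (2 * l n < n)%N) ->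
  (((l (2 * k + 6)%N)%:R - eta * ((2 * k + 6)%N)%:R)
     / Num.sqrt ((2 * k + 6)%N)%:R : R) @[k --> \oo] --> (0 : R) ->
  (forall m0 : nat,
     ((m (2 * k + 6)%N)%:R : R) @[k --> \oo] --> (m0%:R : R) ->
     (p1 (2 * k + 6) (m (2 * k + 6)%N) (l (2 * k + 6)%N) : R)
       @[k --> \oo] --> p_inf m0 eta)
  /\
  (((m (2 * k + 6)%N)%:R : R) @[k --> \oo] --> +oo ->
     (p1 (2 * k + 6) (m (2 * k + 6)%N) (l (2 * k + 6)%N) : R)
       @[k --> \oo] --> (1 : R)
     /\ p_inf M eta @[M --> \oo] --> (1 : R)).
Proof.
move=> eta_bounds _ m_small l_bounds l_eta.
pose N k := (2 * k + 6)%N.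
have NE k : ~~ odd (N k) by rewrite /N oddD oddM.
have l_bounds' k := l_bounds (N k) (leq_addl _ _) (NE k).
pose x k : R := (l (N k))%:R / (N k)%:R.
have x_eta : x k @[k --> \oo] --> eta.
  apply/subr_cvg0.
  (* The difference is [(l - eta * n) / n], and [n >= sqrt n]. *)
  apply: cvg0_dominated l_eta => k.
  have N0 : 0 < (N k)%:R :> R by rewrite ltr0n /N addnS.
  have -> : x k - eta = ((l (N k))%:R - eta * (N k)%:R) / (N k)%:R.
    by rewrite /x mulrBl mulfK // gt_eqF.
  rewrite !normrM; apply: ler_wpM2l => //.
  have s0 : 0 < Num.sqrt (N k)%:R :> R by rewrite sqrtr_gt0.
  rewrite !gtr0_norm ?invr_gt0 // lef_pV2 ?posrE //.
  rewrite -[leRHS](sqr_sqrtr (ltW N0)) expr2 ler_peMl ?(ltW s0) //.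
  by rewrite -[leLHS]sqrtr1 ler_wsqrtr // ler1n /N addnS.
have p1_close : p1 (N k) (m (N k)) (l (N k)) - p_inf (m (N k)) (x k)
    @[k --> \oo] --> (0 : R).
  have : 4 * ((m (N k))%:R / Num.sqrt (N k)%:R) ^+ 2 @[k --> \oo] --> (0 : R).
    have := cvgMl_tmp (a := 4) (cvgM m_small m_small); rewrite !mulr0.
    exact.
  apply: cvg0_dominated => k.
  have [l2 ln] := l_bounds' k; apply: le_trans (ler_norm _).
  exact: p1_approx.
have via (q : R) : p_inf (m (N k)) (x k) @[k --> \oo] --> q ->
    p1 (N k) (m (N k)) (l (N k)) @[k --> \oo] --> q.
  exact: cvg_sub0 p1_close.
split=> [m0 m_m0|m_oo].
  apply: via.
  have : p_inf m0 (x k) @[k --> \oo] --> p_inf m0 eta.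
    exact: (cvg_comp _ _ x_eta (p_inf_continuous R m0 eta)).
  apply: cvg_trans; apply: near_eq_cvg; near=> k.
  (* A convergent sequence of integers is eventually constant: two integers at distance below 1 are
     equal. *)
  suff -> : m (N k) = m0 by [].
  have : `|m0%:R - (m (N k))%:R| < 1 :> R.
    by near: k; move/cvgrPdist_lt : m_m0; exact.
  by rewrite ltr_distlC ltrBlDr !natr1 !ltr_nat; lia.
split; first exact: via (p_inf_cvg1 _ _ _ _ eta_bounds m_oo x_eta).
(* The same lemma with the parameter held constant gives the limit in [M]. *)
exact: (p_inf_cvg1 _ id (fun=> eta) _ eta_bounds cvgr_idn (cvg_cst _)).
Unshelve. all: by end_near. Qed.
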